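(* Let $(M,g)$ be a $4$-dimensional spacetime threaded by a (not necessarily normalized) timelike vector field $\xi=\partial/\partial x^0$, with the notation of the context. The curvature tensor $R$ of $(M,g)$ and the curvature $\bar R$ of the Riemannian spatial connection are related by the structure equations $$\begin{aligned} R_{iljk}&=\bar R_{iljk}+\Phi^{-2}\big(K_{ij}K_{lk}-K_{ik}K_{lj}\big),\\ R_{i0jk}&=K_{ik|j}-K_{ij|k}+K_{ij}c_k-K_{ik}c_j+2\Phi^2b_i\omega_{jk},\\ R_{il0k}&=\bar R_{il0k}+b_iK_{lk}-b_lK_{ik},\\ R_{i00k}&=K_{ik|0}+K_{ij}K^j_k-\Psi K_{ik}-\Phi^2\big(b_{i|k}+b_ib_k\big), \end{aligned}$$ and, equivalently, in terms of the expansion and vorticity tensor fields, $$\begin{aligned} R_{iljk}&=\bar R_{iljk}+\Phi^2\Big\{(\omega_{ij}+\Phi^{-2}\Theta_{ij})(\omega_{lk}+\Phi^{-2}\Theta_{lk})-(\omega_{ik}+\Phi^{-2}\Theta_{ik})(\omega_{lj}+\Phi^{-2}\Theta_{lj})\Big\},\\ R_{i0jk}&=\Theta_{ik|j}-\Theta_{ij|k}+\Theta_{ij}c_k-\Theta_{ik}c_j+\Phi^2\big\{\omega_{ik|j}-\omega_{ij|k}+\omega_{ik}c_j-\omega_{ij}c_k+2b_i\omega_{jk}\big\},\\ R_{il0k}&=\bar R_{il0k}+b_i\Theta_{lk}-b_l\Theta_{ik}+\Phi^2\big(b_i\omega_{lk}-b_l\omega_{ik}\big),\\ R_{i00k}&=\Theta_{ik|0}-\Psi\Theta_{ik}+\Phi^2\Big\{\omega_{ik|0}+\Psi\omega_{ik}+(\omega_{ij}+\Phi^{-2}\Theta_{ij})(\Theta^j_k+\Phi^2\omega^j_k)-b_{i|k}-b_ib_k\Big\}.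 \end{aligned}$$
   Context: Indices $h,i,j,k,l$ run over $\{1,2,3\}$; the summation convention is used. $(M,g)$ is a $4$-dimensional spacetime with Lorentz metric of signature $(-,+,+,+)$ and Levi-Civita connection $\nabla$. $\xi$ is a timelike vector field; $TM=VM\oplus SM$, where $VM$ is spanned by $\xi$ and the spatial distribution $SM$ (not assumed integrable) is its orthogonal complement; $\mathcal S$ denotes the projection onto $SM$. Local coordinates $(x^0,x^i)$ are chosen with $\xi=\partial/\partial x^0$. Put $g(\partial_{x^0},\partial_{x^0})=-\Phi^2$ with $\Phi$ a nowhere zero function, $\xi_i=g(\partial_{x^i},\partial_{x^0})$, $A_i=-\Phi^{-2}\xi_i$, and $\frac{\delta}{\delta x^i}=\frac{\partial}{\partial x^i}-A_i\frac{\partial}{\partial x^0}$ (a local frame of $SM$). Define $$\omega_{ij}=\tfrac12\Big(\frac{\delta A_j}{\delta x^i}-\frac{\delta A_i}{\delta x^j}\Big),\quad a_i=-\frac{\partial A_i}{\partial x^0},\quad c_i=\Phi^{-1}\frac{\delta\Phi}{\delta x^i},\quad b_i=a_i+c_i,\quad \Psi=\Phi^{-1}\frac{\partial\Phi}{\partial x^0},$$ $$\bar g_{ij}=g\Big(\frac{\delta}{\delta x^i},\frac{\delta}{\delta x^j}\Big),\quad \Theta_{ij}=\tfrac12\frac{\partial\bar g_{ij}}{\partial x^0},\quad K_{ij}=\Theta_{ij}+\Phi^2\omega_{ij}.$$ Indices are raised and lowered with $\bar g$; for mixed components the first index is raised: $\omega^k_j=\bar g^{ki}\omega_{ij}$,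 $K^k_j=\bar g^{ki}K_{ij}=\Theta^k_j+\Phi^2\omega^k_j$. The Riemannian spatial connection is the metric connection on $SM$ given by $\bar\nabla_X\mathcal SY=\mathcal S\nabla_X\mathcal SY$; locally $\bar\nabla_{\delta/\delta x^j}\frac{\delta}{\delta x^i}=\bar\Gamma^{\ k}_{i\ j}\frac{\delta}{\delta x^k}$ and $\bar\nabla_{\partial/\partial x^0}\frac{\delta}{\delta x^i}=K^k_i\frac{\delta}{\delta x^k}$, with $\bar\Gamma^{\ k}_{i\ j}=\tfrac12\bar g^{kh}\big(\frac{\delta\bar g_{hj}}{\delta x^i}+\frac{\delta\bar g_{hi}}{\delta x^j}-\frac{\delta\bar g_{ij}}{\delta x^h}\big)$. A vertical bar denotes the induced covariant derivatives of spatial tensor fields, e.g. $T^j_{i|k}=\frac{\delta T^j_i}{\delta x^k}+T^h_i\bar\Gamma^{\ j}_{h\ k}-T^j_h\bar\Gamma^{\ h}_{i\ k}$ and $T^j_{i|0}=\frac{\partial T^j_i}{\partial x^0}+T^h_iK^j_h-T^j_hK^h_i$, and similarly for other types. Curvature conventions: $R(X,Y)Z=\nabla_X\nabla_YZ-\nabla_Y\nabla_XZ-\nabla_{[X,Y]}Z$, $R(X,Y,Z,W)=g(R(X,Y)W,Z)$; $\bar R(X,Y,Z)=\bar\nabla_X\bar\nabla_Y\mathcal SZ-\bar\nabla_Y\bar\nabla_X\mathcal SZ-\bar\nabla_{[X,Y]}\mathcal SZ$, $\bar R(X,Y,\mathcal SZ,\mathcal SW)=\bar g(\bar R(X,Y,\mathcal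 SW),\mathcal SZ)$. Components: $$R_{iljk}=R\Big(\frac{\delta}{\delta x^k},\frac{\delta}{\delta x^j},\frac{\delta}{\delta x^l},\frac{\delta}{\delta x^i}\Big),\quad R_{i0jk}=R\Big(\frac{\delta}{\delta x^k},\frac{\delta}{\delta x^j},\frac{\partial}{\partial x^0},\frac{\delta}{\delta x^i}\Big),$$ $$R_{il0k}=R\Big(\frac{\delta}{\delta x^k},\frac{\partial}{\partial x^0},\frac{\delta}{\delta x^l},\frac{\delta}{\delta x^i}\Big),\quad R_{i00k}=R\Big(\frac{\delta}{\delta x^k},\frac{\partial}{\partial x^0},\frac{\partial}{\partial x^0},\frac{\delta}{\delta x^i}\Big),$$ $$\bar R_{iljk}=\bar R\Big(\frac{\delta}{\delta x^k},\frac{\delta}{\delta x^j},\frac{\delta}{\delta x^l},\frac{\delta}{\delta x^i}\Big),\quad \bar R_{il0k}=\bar R\Big(\frac{\delta}{\delta x^k},\frac{\partial}{\partial x^0},\frac{\delta}{\delta x^l},\frac{\delta}{\delta x^i}\Big).$$ *)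

(* Defs.v *)
From HB Require Import structures.
From mathcomp Require Import all_boot all_order all_algebra.
From mathcomp Require Import all_classical all_reals all_analysis.

Set Implicit Arguments.
Unset Strict Implicit.
Unset Printing Implicit Defensive.

Import Order.TTheory GRing.Theory Num.Theory.
Import numFieldNormedType.Exports.

Local Open Scope classical_set_scope.
Local Open Scope ring_scope.

(* Everything is written in a coordinate chart (x^0,x^1,x^2,x^3), i.e. on a
   subset of R^4 = 'rV[R]_4. Scalar fields and vector fields are total
   functions; only their germs at points of the (open) chart domain matter.
   A vector field is given by its components in the coordinate frame. *)
Definition scalar_field (R : realType) := 'rV[R]_4 -> R.
Definition vector_field (R : realType) := 'rV[R]_4 -> 'rV[R]_4.

(* The spatial index i in {1,2,3} is encoded as i : 'I_3, and sp i : 'I_4 is the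
   corresponding coordinate index; the time index is ord0 : 'I_4. *)
Definition sp (i : 'I_3) : 'I_4 := lift ord0 i.

Section Calculus.
Variable R : realType.

Definition coord_vf (a : 'I_4) : vector_field R := fun=> delta_mx 0 a.

Definition pd (a : 'I_4) (f : scalar_field R) : scalar_field R :=
  fun x => 'D_(delta_mx 0 a) f x.

(* C^infinity on U: all iterated partial derivatives exist and are Frechet
   differentiable (hence continuous) at every point of U. *)
Definition smooth_on (U : set 'rV[R]_4) (f : scalar_field R) : Prop :=
  forall (s : seq 'I_4) (x : 'rV[R]_4), U x -> differentiable (foldr pd f s) x.

Definition vact (X : vector_field R) (f : scalar_field R) : scalar_field R :=
  fun x => \sum_a X x 0 a * pd a f x.

Definition lie_bracket (X Y : vector_field R) : vector_field R :=
  fun x => \row_c (vact X (fun y => Y y 0 c) x - vact Y (fun y => X y 0 c) x).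

Definition minkowski : 'M[R]_4 :=
  diag_mx (\row_a (if a == ord0 then -1 else 1)).

(* Symmetric bilinear form of signature (-,+,+,+). *)
Definition lorentzian (G : 'M[R]_4) : Prop :=
  G^T = G /\ exists2 P : 'M[R]_4, P \in unitmx & P *m G *m P^T = minkowski.

End Calculus.

Arguments coord_vf R a : clear implicits.

Definition xi (R : realType) : vector_field R := coord_vf R ord0.
Arguments xi R : clear implicits.

Section Geometry.
Variables (R : realType) (g : 'rV[R]_4 -> 'M[R]_4).

Definition gdot (X Y : vector_field R) : scalar_field R :=
  fun x => \sum_a \sum_b g x a b * X x 0 a * Y x 0 b.

(* christoffel c a b is Gamma^c_{a b}, the Levi-Civita connection coefficients. *)
Definition christoffel (c a b : 'I_4) : scalar_field R :=
  fun x => 2^-1 * \sum_d invmx (g x) c d *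
    (pd a (fun y => g y d b) x + pd b (fun y => g y d a) x
     - pd d (fun y => g y a b) x).

Definition nabla (X Y : vector_field R) : vector_field R :=
  fun x => \row_c (vact X (fun y => Y y 0 c) x
    + \sum_a \sum_b christoffel c a b x * X x 0 a * Y x 0 b).

Definition riemann (X Y Z : vector_field R) : vector_field R :=
  fun x => nabla X (nabla Y Z) x - nabla Y (nabla X Z) x
           - nabla (lie_bracket X Y) Z x.

(* R(X,Y,Z,W) = g(R(X,Y)W,Z): note the order of Z and W. *)
Definition riemann4 (X Y Z W : vector_field R) : scalar_field R :=
  gdot (riemann X Y W) Z.

Definition sproj (X : vector_field R) : vector_field R :=
  fun x => X x - (gdot X (xi R) x / gdot (xi R) (xi R) x) *: xi R x.

Definition snabla (X Y : vector_field R) : vector_field R :=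
  sproj (nabla X (sproj Y)).

Definition sriemann (X Y Z : vector_field R) : vector_field R :=
  fun x => snabla X (snabla Y (sproj Z)) x - snabla Y (snabla X (sproj Z)) x
           - snabla (lie_bracket X Y) (sproj Z) x.

Definition sriemann4 (X Y Z W : vector_field R) : scalar_field R :=
  gdot (sriemann X Y W) (sproj Z).

End Geometry.

Section Threading.
Variables (R : realType) (g : 'rV[R]_4 -> 'M[R]_4) (Phi : scalar_field R).

Definition A (i : 'I_3) : scalar_field R :=
  fun x => - (Phi x ^- 2 * gdot g (coord_vf R (sp i)) (xi R) x).

(* delta_i is the spatial frame field delta/delta x^i. *)
Definition delta (i : 'I_3) : vector_field R :=
  fun x => coord_vf R (sp i) x - A i x *: xi R x.

Definition omega (i j : 'I_3) : scalar_field R :=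
  fun x => 2^-1 * (vact (delta i) (A j) x - vact (delta j) (A i) x).

Definition a_ (i : 'I_3) : scalar_field R := fun x => - pd ord0 (A i) x.

Definition c_ (i : 'I_3) : scalar_field R :=
  fun x => (Phi x)^-1 * vact (delta i) Phi x.

Definition b_ (i : 'I_3) : scalar_field R := fun x => a_ i x + c_ i x.

Definition Psi : scalar_field R := fun x => (Phi x)^-1 * pd ord0 Phi x.

Definition gbar (i j : 'I_3) : scalar_field R := gdot g (delta i) (delta j).

Definition gbar_inv (i j : 'I_3) : scalar_field R :=
  fun x => invmx (\matrix_(h, k) gbar h k x) i j.

Definition Theta (i j : 'I_3) : scalar_field R :=
  fun x => 2^-1 * pd ord0 (gbar i j) x.

Definition K (i j : 'I_3) : scalar_field R :=
  fun x => Theta i j x + Phi x ^+ 2 * omega i j x.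

(* raise T k j is T^k_j = gbar^{ki} T_{ij}. *)
Definition raise (T : 'I_3 -> 'I_3 -> scalar_field R) (k j : 'I_3) :
    scalar_field R :=
  fun x => \sum_i gbar_inv k i x * T i j x.

(* sGamma k i j is the coefficient of delta_k in snabla_{delta_j} delta_i. *)
Definition sGamma (k i j : 'I_3) : scalar_field R :=
  fun x => 2^-1 * \sum_h gbar_inv k h x *
    (vact (delta i) (gbar h j) x + vact (delta j) (gbar h i) x
     - vact (delta h) (gbar i j) x).

(* T_{i|k} *)
Definition bar1 (T : 'I_3 -> scalar_field R) (i k : 'I_3) : scalar_field R :=
  fun x => vact (delta k) (T i) x - \sum_h T h x * sGamma h i k x.

(* T_{ij|k} *)
Definition bar2 (T : 'I_3 -> 'I_3 -> scalar_field R) (i j k : 'I_3) :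
    scalar_field R :=
  fun x => vact (delta k) (T i j) x
    - \sum_h T h j x * sGamma h i k x - \sum_h T i h x * sGamma h j k x.

(* T_{ij|0} *)
Definition bar2_0 (T : 'I_3 -> 'I_3 -> scalar_field R) (i j : 'I_3) :
    scalar_field R :=
  fun x => pd ord0 (T i j) x
    - \sum_h T h j x * raise K h i x - \sum_h T i h x * raise K h j x.

Definition R_iljk (i l j k : 'I_3) : scalar_field R :=
  riemann4 g (delta k) (delta j) (delta l) (delta i).

Definition R_i0jk (i j k : 'I_3) : scalar_field R :=
  riemann4 g (delta k) (delta j) (xi R) (delta i).

Definition R_il0k (i l k : 'I_3) : scalar_field R :=
  riemann4 g (delta k) (xi R) (delta l) (delta i).

Definition R_i00k (i k : 'I_3) : scalar_field R :=
  riemann4 g (delta k) (xi R) (xi R) (delta i).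

Definition Rbar_iljk (i l j k : 'I_3) : scalar_field R :=
  sriemann4 g (delta k) (delta j) (delta l) (delta i).

Definition Rbar_il0k (i l k : 'I_3) : scalar_field R :=
  sriemann4 g (delta k) (xi R) (delta l) (delta i).

End Threading.

(* Main.v *)
Require Import Defs.
From HB Require Import structures.
From mathcomp Require Import all_boot all_order all_algebra.
From mathcomp Require Import all_classical all_reals all_analysis.
From mathcomp Require Import ring.

Set Implicit Arguments.
Unset Strict Implicit.
Unset Printing Implicit Defensive.

Import Order.TTheory GRing.Theory Num.Theory.
Import numFieldNormedType.Exports.

Local Open Scope classical_set_scope.
Local Open Scope ring_scope.

(** Write n for the Levi-Civita connection. On the frame formed by delta_1,
    delta_2, delta_3 and xi every bracket is vertical: [delta_i, delta_j] is
    -2 omega_ij xi and [delta_k, xi] is -a_k xi. The Koszul formula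
    ([koszul]) therefore gives every product of n_X Y with a frame field in terms
    of gbar and its derivatives, K, b, c and Psi: the symmetric part Theta of K
    comes from differentiating gbar along xi, and its antisymmetric part
    Phi^2 omega from the brackets. These are the lemmas [nabla_delta_delta_xi] to
    [nabla_xi_xi_xi].

    Two identities then carry the theorem.

    - [gauss]: for spatial Z, the spatial connection is n_Y Z with its component
      along xi removed. Differentiating once more and pairing with a spatial
      field W, the removed component contributes only through g(n_X xi, W),
      because xi itself is orthogonal to W. The difference of R and Rbar is thus
      quadratic in first-order data, which gives the equations for R_iljk and
      R_il0k.

    - [codazzi]: metricity moves the outer derivative in g(n_X n_Y Z, xi) onto
      the scalar g(n_Y Z, xi), at the price of the product of n_Y Z with n_X xi.
      That product is expanded in the frame by [frame_parseval], where the
      coefficients of the spatial connection and the mixed components of K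
      appear. This gives the equations for R_i0jk and R_i00k.

    The second family of equations follows from the first by the Leibniz rule for
    K = Theta + Phi^2 omega ([bar2_K] and [bar2_0_K]).

    All of this needs the Leibniz rule for the fields that occur, so the first
    part shows that smooth functions on an open set are closed under the
    algebraic operations, under inversion and under partial derivatives. *)

(** * Smooth functions on an open set *)

Section Smooth.
Variables (R : realType) (U : set 'rV[R]_4).
Hypothesis U_open : open U.
Implicit Types f h : scalar_field R.

Lemma pd_eq_on a f h x :
  (forall y, U y -> f y = h y) -> U x -> pd a f x = pd a h x.
Proof.
move=> fh Ux; apply: near_eq_derive.
exact: filterS (open_nbhs_nbhs (conj U_open Ux)).
Qed.

(** The differential of [f] serves for [h], as the remainder only has to be
    controlled near the point. *)
Lemma diff_eq_near f h x : (\near x, f x = h x) ->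
  differentiable f x -> differentiable h x.
Proof.
move=> fh df; have fhx : f x = h x by exact: (nbhs_singleton fh).
have [dc df0] := (iffLR (diff_locallyP _ _)) df.
have dh : h \o shift x = cst (h x) + 'd f x +o_ 0 id.
  apply/eqaddoP => e e0.
  have fh0 : \forall y \near (0 : 'rV[R]_4), f (y + x) = h (y + x).
    by move: fh; rewrite (near_shift 0 x) /= subr0.
  have /eqaddoP /(_ e e0) fo := df0.
  by apply: filterS2 fh0 fo => y fhy; rewrite -fhx !fctE /= fhy.
have dE := diff_unique dc dh.
by apply/diff_locallyP; rewrite dE.
Qed.

(** Expressions built from smooth functions by ring operations, inversion and
    modification outside [U]. The derivative of a product involves new products
    of lower-order derivatives, so smoothness of a product is not an induction on
    the list of derivatives alone; this class is closed under partial
    derivatives and consists of differentiable functions, which is enough. *)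
Inductive smooth_expr : scalar_field R -> Prop :=
| SmoothBase f : smooth_on U f -> smooth_expr f
| SmoothCst (c : R) : smooth_expr (fun=> c)
| SmoothAdd f h :
    smooth_expr f -> smooth_expr h -> smooth_expr (fun x => f x + h x)
| SmoothMul f h :
    smooth_expr f -> smooth_expr h -> smooth_expr (fun x => f x * h x)
| SmoothInv f : (forall x, U x -> f x != 0) ->
    smooth_expr f -> smooth_expr (fun x => (f x)^-1)
| SmoothEq f h :
    (forall x, U x -> f x = h x) -> smooth_expr f -> smooth_expr h.

Lemma smooth_diff f x : smooth_on U f -> U x -> differentiable f x.
Proof. by move=> sf Ux; apply: (sf [::]). Qed.

Lemma smooth_pd a f : smooth_on U f -> smooth_on U (pd a f).
Proof. by move=> sf s x Ux; have := sf (rcons s a) x Ux; rewrite foldr_rcons. Qed.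

Lemma pd_cst a (c : R) x : pd a (fun=> c) x = 0.
Proof. exact: derive_cst. Qed.

Lemma diff_pdD a f h x : differentiable f x -> differentiable h x ->
  pd a (fun y => f y + h y) x = pd a f x + pd a h x.
Proof. by move=> df dh; apply: deriveD; apply: diff_derivable. Qed.

Lemma diff_pdM a f h x : differentiable f x -> differentiable h x ->
  pd a (fun y => f y * h y) x = pd a f x * h x + f x * pd a h x.
Proof.
move=> df dh; rewrite /pd.
rewrite (deriveM (f := f) (g := h)); [|exact: diff_derivable..].
by rewrite addrC mulrC.
Qed.

Lemma diff_pdV a f x : differentiable f x -> f x != 0 ->
  pd a (fun y => (f y)^-1) x = - (f x)^-1 * (f x)^-1 * pd a f x.
Proof.
move=> df fx0; rewrite /pd deriveV//; last exact: diff_derivable.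
by rewrite expr2 invfM mulNr.
Qed.

Lemma smooth_expr_closed f : smooth_expr f ->
  (forall x, U x -> differentiable f x) /\ (forall a, smooth_expr (pd a f)).
Proof.
elim=> {f} [f sf|c|f h _ [df pf] _ [dh ph]|f h sf [df pf] sh [dh ph]
           |f f0 sf [df pf]|f h fh _ [df pf]].
- split=> [x Ux|a]; first exact: smooth_diff.
  by apply: SmoothBase; apply: smooth_pd.
- split=> [x Ux|a]; first exact: differentiable_cst.
  apply: (SmoothEq (f := fun=> 0)); last exact: SmoothCst.
  by move=> x _; rewrite pd_cst.
- split=> [x Ux|a]; first exact: differentiableD (df x Ux) (dh x Ux).
  apply: SmoothEq (SmoothAdd (pf a) (ph a)) => x Ux.
  by rewrite diff_pdD//; auto.
- split=> [x Ux|a]; first exact: differentiableM (df x Ux) (dh x Ux).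
  apply: SmoothEq (SmoothAdd (SmoothMul (pf a) sh) (SmoothMul sf (ph a))) => x Ux.
  by rewrite diff_pdM//; auto.
- split=> [x Ux|a]; first exact: differentiableV (df x Ux) (f0 x Ux).
  have sV := SmoothInv f0 sf.
  apply: SmoothEq (SmoothMul (SmoothMul (SmoothMul (SmoothCst (-1)) sV) sV) (pf a)).
  by move=> x Ux; rewrite diff_pdV ?mulN1r//; auto.
- split=> [x Ux|a].
    apply: diff_eq_near (df x Ux).
    exact: filterS (open_nbhs_nbhs (conj U_open Ux)).
  by apply: SmoothEq (pf a) => x Ux; apply: pd_eq_on.
Qed.

Lemma smooth_exprW f : smooth_expr f -> smooth_on U f.
Proof.
move=> sf s x Ux; suff sfs : smooth_expr (foldr (@pd R) f s).
  by case: (smooth_expr_closed sfs) => d _; apply: d.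
elim: s => //= a s IHs; by case: (smooth_expr_closed IHs) => _ p; apply: p.
Qed.

Lemma smooth_eq f h :
  (forall x, U x -> f x = h x) -> smooth_on U f -> smooth_on U h.
Proof.
by move=> fh sf; apply: smooth_exprW; apply: SmoothEq fh _; apply: SmoothBase.
Qed.

Lemma smooth_cst (c : R) : smooth_on U (fun=> c).
Proof. exact/smooth_exprW/SmoothCst. Qed.

Lemma smoothD f h :
  smooth_on U f -> smooth_on U h -> smooth_on U (fun x => f x + h x).
Proof. by move=> sf sh; apply/smooth_exprW/SmoothAdd; apply: SmoothBase. Qed.

Lemma smoothM f h :
  smooth_on U f -> smooth_on U h -> smooth_on U (fun x => f x * h x).
Proof. by move=> sf sh; apply/smooth_exprW/SmoothMul; apply: SmoothBase. Qed.

Lemma smoothV f : (forall x, U x -> f x != 0) ->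
  smooth_on U f -> smooth_on U (fun x => (f x)^-1).
Proof. by move=> f0 sf; apply/smooth_exprW/SmoothInv => //; apply: SmoothBase. Qed.

Lemma smoothN f : smooth_on U f -> smooth_on U (fun x => - f x).
Proof.
move=> sf; apply: smooth_eq (smoothM (smooth_cst (-1)) sf) => x _.
by rewrite mulN1r.
Qed.

Lemma smoothB f h :
  smooth_on U f -> smooth_on U h -> smooth_on U (fun x => f x - h x).
Proof. by move=> sf sh; apply: smoothD (smoothN sh). Qed.

Lemma smoothX f n : smooth_on U f -> smooth_on U (fun x => f x ^+ n).
Proof.
move=> sf; elim: n => [|n IHn]; first exact: smooth_cst.
by apply: smooth_eq (smoothM sf IHn) => x _; rewrite exprS.
Qed.

Lemma smooth_sum (I : Type) (r : seq I) (F : I -> scalar_field R) :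
  (forall i, smooth_on U (F i)) -> smooth_on U (fun x => \sum_(i <- r) F i x).
Proof.
move=> sF; elim: r => [|i r IHr].
  by apply: smooth_eq (smooth_cst 0) => x _; rewrite big_nil.
by apply: smooth_eq (smoothD (sF i) IHr) => x _; rewrite big_cons.
Qed.

Lemma smooth_prod (I : Type) (r : seq I) (F : I -> scalar_field R) :
  (forall i, smooth_on U (F i)) -> smooth_on U (fun x => \prod_(i <- r) F i x).
Proof.
move=> sF; elim: r => [|i r IHr].
  by apply: smooth_eq (smooth_cst 1) => x _; rewrite big_nil.
by apply: smooth_eq (smoothM (sF i) IHr) => x _; rewrite big_cons.
Qed.

Lemma smooth_det n (M : 'rV[R]_4 -> 'M[R]_n) :
  (forall i j, smooth_on U (fun x => M x i j)) ->
  smooth_on U (fun x => \det (M x)).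
Proof.
move=> sM; rewrite /determinant; apply: smooth_sum => s.
apply: smoothM; first exact: smooth_cst.
exact: smooth_prod.
Qed.

(** By Cramer's rule the inverse is a quotient of polynomials in the entries. *)
Lemma smooth_invmx n (M : 'rV[R]_4 -> 'M[R]_n) :
  (forall x, U x -> M x \in unitmx) ->
  (forall i j, smooth_on U (fun x => M x i j)) ->
  forall i j, smooth_on U (fun x => invmx (M x) i j).
Proof.
move=> uM sM i j.
apply: (smooth_eq (f := fun x => (\det (M x))^-1 * cofactor (M x) j i)).
  by move=> x Ux; rewrite /invmx uM// !mxE.
apply: smoothM.
  apply: smoothV; last exact: smooth_det.
  by move=> x Ux; have := uM x Ux; rewrite unitmxE unitfE.
rewrite /cofactor; apply: smoothM; first exact: smooth_cst.
apply: smooth_det => h k.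
by apply: smooth_eq (sM (lift j h) (lift i k)) => x _; rewrite !mxE.
Qed.

Section Rules.
Variables (x : 'rV[R]_4) (Ux : U x).

Lemma pdD a f h : smooth_on U f -> smooth_on U h ->
  pd a (fun y => f y + h y) x = pd a f x + pd a h x.
Proof. by move=> sf sh; apply: diff_pdD; apply: smooth_diff. Qed.

Lemma pdM a f h : smooth_on U f -> smooth_on U h ->
  pd a (fun y => f y * h y) x = pd a f x * h x + f x * pd a h x.
Proof. by move=> sf sh; apply: diff_pdM; apply: smooth_diff. Qed.

Lemma pdN a f : smooth_on U f -> pd a (fun y => - f y) x = - pd a f x.
Proof.
move=> sf; have := pdM a (smooth_cst (-1)) sf.
rewrite pd_cst mul0r add0r mulN1r => <-.
by apply: pd_eq_on => // y _; rewrite mulN1r.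
Qed.

Lemma pd_sum a (I : Type) (r : seq I) (F : I -> scalar_field R) :
  (forall i, smooth_on U (F i)) ->
  pd a (fun y => \sum_(i <- r) F i y) x = \sum_(i <- r) pd a (F i) x.
Proof.
move=> sF; elim: r => [|i r IHr].
  rewrite big_nil -[RHS](pd_cst a 0 x).
  by apply: pd_eq_on => // y _; rewrite big_nil.
rewrite big_cons -IHr -pdD//; last exact: smooth_sum.
by apply: pd_eq_on => // y _; rewrite big_cons.
Qed.

Lemma vact_eq_on (X : vector_field R) f h :
  (forall y, U y -> f y = h y) -> vact X f x = vact X h x.
Proof.
by move=> fh; apply: eq_bigr => a _; congr (_ * _); apply: pd_eq_on.
Qed.

Lemma vact_cst (X : vector_field R) (c : R) : vact X (fun=> c) x = 0.
Proof. by apply: big1 => a _; rewrite pd_cst mulr0. Qed.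

Lemma vactD (X : vector_field R) f h :
  smooth_on U f -> smooth_on U h ->
  vact X (fun y => f y + h y) x = vact X f x + vact X h x.
Proof.
move=> sf sh; rewrite /vact -big_split; apply: eq_bigr => a _ /=.
by rewrite pdD// mulrDr.
Qed.

Lemma vactN (X : vector_field R) f : smooth_on U f ->
  vact X (fun y => - f y) x = - vact X f x.
Proof.
move=> sf; rewrite /vact -sumrN; apply: eq_bigr => a _ /=.
by rewrite pdN// mulrN.
Qed.

Lemma vactM (X : vector_field R) f h :
  smooth_on U f -> smooth_on U h ->
  vact X (fun y => f y * h y) x = vact X f x * h x + f x * vact X h x.
Proof.
move=> sf sh; rewrite /vact mulr_sumr mulr_suml -big_split.
apply: eq_bigr => a _ /=; rewrite pdM//; ring.
Qed.

End Rules.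

Lemma vact_xi f x : vact (xi R) f x = pd ord0 f x.
Proof.
rewrite /vact (bigD1 ord0)//= big1 ?addr0; first by rewrite mxE eqxx mul1r.
by move=> a /negPf a0; rewrite mxE a0 mul0r.
Qed.

Lemma smooth_vact (X : vector_field R) f :
  (forall a, smooth_on U (fun x => X x 0 a)) -> smooth_on U f ->
  smooth_on U (vact X f).
Proof.
by move=> sX sf; apply: smooth_sum => a; apply: smoothM => //; apply: smooth_pd.
Qed.

End Smooth.

(** * The Levi-Civita connection *)

Definition vsmooth_on (R : realType) (U : set 'rV[R]_4) (X : vector_field R) :=
  forall c, smooth_on U (fun x => X x 0 c).

Section Dot.
Variables (R : realType) (n : nat).
Implicit Types (M : 'M[R]_n) (u v w : 'rV[R]_n).

Definition dot M u v : R := (u *m M *m v^T) 0 0.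

Lemma dotE M u v : dot M u v = \sum_a \sum_b M a b * u 0 a * v 0 b.
Proof.
rewrite /dot mxE exchange_big; apply: eq_bigr => b _.
rewrite !mxE mulr_suml; apply: eq_bigr => a _.
by rewrite [M a b * _]mulrC.
Qed.

Lemma dotC M u v : M^T = M -> dot M u v = dot M v u.
Proof.
move=> sM; rewrite /dot -[u *m M *m v^T]trmxK mxE.
by rewrite !trmx_mul trmxK sM mulmxA.
Qed.

Lemma dotDl M u v w : dot M (u + v) w = dot M u w + dot M v w.
Proof. by rewrite /dot !mulmxDl mxE. Qed.

Lemma dotDr M u v w : dot M w (u + v) = dot M w u + dot M w v.
Proof. by rewrite /dot linearD mulmxDr mxE. Qed.

Lemma dotZl M (c : R) u v : dot M (c *: u) v = c * dot M u v.
Proof. by rewrite /dot -!scalemxAl mxE. Qed.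

Lemma dotZr M (c : R) u v : dot M u (c *: v) = c * dot M u v.
Proof. by rewrite /dot linearZ -scalemxAr mxE. Qed.

Lemma dotNl M u v : dot M (- u) v = - dot M u v.
Proof. by rewrite -scaleN1r dotZl mulN1r. Qed.

Lemma dotBl M u v w : dot M (u - v) w = dot M u w - dot M v w.
Proof. by rewrite dotDl dotNl. Qed.

Lemma dot_sumr M u (I : Type) (r : seq I) (F : I -> 'rV[R]_n) :
  dot M u (\sum_(i <- r) F i) = \sum_(i <- r) dot M u (F i).
Proof.
elim: r => [|i r IHr]; last by rewrite !big_cons dotDr IHr.
by rewrite !big_nil -(scale0r 0) dotZr mul0r.
Qed.

Lemma dot_suml M u (I : Type) (r : seq I) (F : I -> 'rV[R]_n) :
  dot M (\sum_(i <- r) F i) u = \sum_(i <- r) dot M (F i) u.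
Proof.
elim: r => [|i r IHr]; last by rewrite !big_cons dotDl IHr.
by rewrite !big_nil -(scale0r 0) dotZl mul0r.
Qed.

End Dot.

Section LeviCivita.
Variables (R : realType) (U : set 'rV[R]_4) (g : 'rV[R]_4 -> 'M[R]_4).
Hypothesis U_open : open U.
Hypothesis g_smooth : forall a b, smooth_on U (fun x => g x a b).
Hypothesis g_sym : forall x, U x -> (g x)^T = g x.
Hypothesis g_unit : forall x, U x -> g x \in unitmx.
Implicit Types X Y Z : vector_field R.

Lemma gdotE X Y x : gdot g X Y x = dot (g x) (X x) (Y x).
Proof. by rewrite dotE. Qed.

Lemma smooth_gdot X Y : vsmooth_on U X -> vsmooth_on U Y ->
  smooth_on U (gdot g X Y).
Proof.
move=> sX sY; apply: smooth_sum => // a; apply: smooth_sum => // b.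
by apply: smoothM => //; apply: smoothM.
Qed.

Lemma smooth_christoffel c a b : smooth_on U (christoffel g c a b).
Proof.
apply: smoothM => //; first exact: smooth_cst.
apply: smooth_sum => // d; apply: smoothM => //; first exact: smooth_invmx.
by do 2?[apply: smoothB || apply: smoothD] => //; apply: smooth_pd.
Qed.

Lemma vsmooth_nabla X Y :
  vsmooth_on U X -> vsmooth_on U Y -> vsmooth_on U (nabla g X Y).
Proof.
move=> sX sY c; apply: (smooth_eq U_open (f := fun x =>
  vact X (fun y => Y y 0 c) x
  + \sum_a \sum_b christoffel g c a b x * X x 0 a * Y x 0 b)).
  by move=> x _; rewrite mxE.
apply: smoothD => //; first exact: smooth_vact.
apply: smooth_sum => // a; apply: smooth_sum => // b.
by apply: smoothM => //; apply: smoothM => //; apply: smooth_christoffel.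
Qed.

Lemma nabla_eq_on X Y Y' x :
  (forall y, U y -> Y y = Y' y) -> U x -> nabla g X Y x = nabla g X Y' x.
Proof.
move=> YY' Ux; apply/rowP => c; rewrite !mxE YY'//; congr (_ + _).
by apply: (vact_eq_on U_open Ux) => // y Uy; rewrite YY'.
Qed.

Lemma nablaZl (c : R) X X' Y x :
  X x = c *: X' x -> nabla g X Y x = c *: nabla g X' Y x.
Proof.
move=> XE; apply/rowP => d; rewrite !mxE /vact XE mulrDr !mulr_sumr.
congr (_ + _); apply: eq_bigr => a _; rewrite ?mulr_sumr ?mxE; first by ring.
by apply: eq_bigr => b _; ring.
Qed.

Lemma nablaDZ X Y Z (f : scalar_field R) x :
  vsmooth_on U Y -> vsmooth_on U Z -> smooth_on U f -> U x ->
  nabla g X (fun y => Y y + f y *: Z y) x =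
  nabla g X Y x + vact X f x *: Z x + f x *: nabla g X Z x.
Proof.
move=> sY sZ sf Ux; apply/rowP => c; rewrite !mxE.
rewrite (vact_eq_on U_open Ux _ (h := fun y => Y y 0 c + f y * Z y 0 c))//; last first.
  by move=> y _; rewrite !mxE.
rewrite (vactD Ux) ?(vactM Ux)//; last exact: smoothM.
set S := \sum_a _; set S1 := \sum_a _; set S2 := \sum_a _.
suff -> : S = S1 + f x * S2 by ring.
rewrite /S /S1 /S2 mulr_sumr -big_split; apply: eq_bigr => a _ /=.
rewrite mulr_sumr -big_split; apply: eq_bigr => b _ /=; rewrite !mxE; ring.
Qed.

(** Lowering the upper index of the Christoffel symbols cancels the inverse
    metric and leaves the symbols of the first kind. *)
Lemma christoffel_lower a b e x : U x ->
  \sum_c g x e c * christoffel g c a b x =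
  2^-1 * (pd a (fun y => g y e b) x + pd b (fun y => g y e a) x
          - pd e (fun y => g y a b) x).
Proof.
move=> Ux; rewrite /christoffel.
pose L d := pd a (fun y => g y d b) x + pd b (fun y => g y d a) x
            - pd d (fun y => g y a b) x.
transitivity (2^-1 * \sum_d (g x *m invmx (g x)) e d * L d).
  rewrite mulr_sumr.
  under eq_bigr => c _ do rewrite mulrCA mulr_sumr mulr_sumr.
  rewrite exchange_big; apply: eq_bigr => d _ /=.
  rewrite mxE mulr_suml mulr_sumr; apply: eq_bigr => c _.
  by rewrite /L; ring.
rewrite mulmxV ?g_unit// (bigD1 e)//= big1 ?addr0 ?mxE ?eqxx ?mul1r// => d ed.
by rewrite mxE eq_sym (negPf ed) mul0r.
Qed.

Lemma pd_gC a b c x : U x ->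
  pd a (fun y => g y b c) x = pd a (fun y => g y c b) x.
Proof.
by move=> Ux; apply: (pd_eq_on U_open) => // y Uy; rewrite -[in LHS]g_sym// mxE.
Qed.

(** Metricity in coordinates: the derivative of the metric splits into two
    Christoffel symbols of the first kind. *)
Lemma christoffel_metric a b c x : U x ->
  \sum_d g x c d * christoffel g d a b x
  + \sum_d g x b d * christoffel g d a c x = pd a (fun y => g y b c) x.
Proof.
move=> Ux; rewrite !christoffel_lower//.
rewrite (pd_gC a c b)// (pd_gC b c a)// (pd_gC c b a)//.
by field.
Qed.

(** Covariant derivative along a coordinate field, in terms of which [nabla] is
    visibly linear in its direction. *)
Definition nabla_coord c Y x : 'rV[R]_4 :=
  \row_a (pd c (fun y => Y y 0 a) x + \sum_b christoffel g a c b x * Y x 0 b).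

Lemma nabla_sum_coord X Y x :
  nabla g X Y x = \sum_c X x 0 c *: nabla_coord c Y x.
Proof.
apply/rowP => a; rewrite summxE !mxE -big_split; apply: eq_bigr => c _ /=.
by rewrite !mxE mulrDr mulr_sumr; congr (_ + _); apply: eq_bigr => b _; ring.
Qed.

Lemma pd_gdot c Y Z x : vsmooth_on U Y -> vsmooth_on U Z -> U x ->
  pd c (gdot g Y Z) x =
  dot (g x) (nabla_coord c Y x) (Z x) + dot (g x) (Y x) (nabla_coord c Z x).
Proof.
move=> sY sZ Ux.
have sYZ a b : smooth_on U (fun y => g y a b * Y y 0 a * Z y 0 b).
  by do 2?apply: smoothM => //.
rewrite (pd_sum U_open Ux)//; last by move=> a; apply: smooth_sum.
transitivity (\sum_a \sum_b
   (g x a b * pd c (fun y => Y y 0 a) x * Z x 0 b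
    + g x a b * Y x 0 a * pd c (fun y => Z y 0 b) x
    + (\sum_d g x b d * christoffel g d c a x) * Y x 0 a * Z x 0 b
    + (\sum_d g x a d * christoffel g d c b x) * Y x 0 a * Z x 0 b)).
  apply: eq_bigr => a _; rewrite (pd_sum U_open Ux)//; apply: eq_bigr => b _.
  rewrite (pdM Ux)//; last by apply: smoothM.
  by rewrite (pdM Ux)// -(christoffel_metric c a b Ux); ring.
rewrite !dotE.
have -> : \sum_a \sum_b g x a b * nabla_coord c Y x 0 a * Z x 0 b =
  \sum_a \sum_b (g x a b * pd c (fun y => Y y 0 a) x * Z x 0 b
    + (\sum_d g x b d * christoffel g d c a x) * Y x 0 a * Z x 0 b).
  transitivity (\sum_b \sum_a g x a b * pd c (fun y => Y y 0 a) x * Z x 0 b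
    + \sum_b \sum_a \sum_d g x b a * christoffel g a c d x * Y x 0 d * Z x 0 b).
    rewrite exchange_big -big_split; apply: eq_bigr => b _ /=.
    rewrite -big_split; apply: eq_bigr => a _ /=.
    rewrite mxE mulrDr mulrDl; congr (_ + _).
    rewrite -[in LHS](g_sym Ux) mxE mulr_sumr mulr_suml.
    by apply: eq_bigr => d _; ring.
  rewrite -big_split [RHS]exchange_big; apply: eq_bigr => b _ /=.
  rewrite [X in _ + X]exchange_big -big_split; apply: eq_bigr => a _ /=.
  by congr (_ + _); rewrite !mulr_suml; apply: eq_bigr => d _.
have -> : \sum_a \sum_b g x a b * Y x 0 a * nabla_coord c Z x 0 b =
  \sum_a \sum_b (g x a b * Y x 0 a * pd c (fun y => Z y 0 b) x
    + (\sum_d g x a d * christoffel g d c b x) * Y x 0 a * Z x 0 b).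
  apply: eq_bigr => a _; rewrite [RHS]big_split /=.
  transitivity (\sum_b g x a b * Y x 0 a * pd c (fun y => Z y 0 b) x
    + \sum_b \sum_d g x a b * christoffel g b c d x * Y x 0 a * Z x 0 d).
    rewrite -big_split; apply: eq_bigr => b _ /=.
    rewrite mxE mulrDr; congr (_ + _); rewrite mulr_sumr.
    by apply: eq_bigr => d _; ring.
  congr (_ + _); rewrite exchange_big; apply: eq_bigr => b _ /=.
  by rewrite !mulr_suml.
rewrite -big_split; apply: eq_bigr => a _ /=.
by rewrite -big_split; apply: eq_bigr => b _ /=; ring.
Qed.

Lemma nabla_metric X Y Z x : vsmooth_on U Y -> vsmooth_on U Z -> U x ->
  vact X (gdot g Y Z) x =
  gdot g (nabla g X Y) Z x + gdot g Y (nabla g X Z) x.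
Proof.
move=> sY sZ Ux; rewrite /vact !gdotE !nabla_sum_coord dot_suml dot_sumr -big_split.
by apply: eq_bigr => c _; rewrite /= pd_gdot// dotZl dotZr mulrDr.
Qed.

Lemma nabla_torsion_free X Y x : U x ->
  nabla g X Y x - nabla g Y X x = lie_bracket X Y x.
Proof.
move=> Ux; apply/rowP => c; rewrite !mxE.
suff -> : \sum_a \sum_b christoffel g c a b x * X x 0 a * Y x 0 b =
          \sum_a \sum_b christoffel g c a b x * Y x 0 a * X x 0 b by ring.
rewrite exchange_big; apply: eq_bigr => a _; apply: eq_bigr => b _ /=.
suff -> : christoffel g c a b x = christoffel g c b a x by ring.
congr (_ * _); apply: eq_bigr => d _; congr (_ * _).
by rewrite (pd_gC d a b)// [X in X - _]addrC.
Qed.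

Lemma gdotC X Y x : U x -> gdot g X Y x = gdot g Y X x.
Proof. by move=> Ux; rewrite !gdotE dotC// g_sym. Qed.

(** The usual derivation: metricity expands the three derivatives of products,
    and the brackets are differences of covariant derivatives. *)
Lemma koszul X Y Z x :
  vsmooth_on U X -> vsmooth_on U Y -> vsmooth_on U Z -> U x ->
  gdot g (nabla g X Y) Z x = 2^-1 *
    (vact X (gdot g Y Z) x + vact Y (gdot g X Z) x - vact Z (gdot g X Y) x
     + gdot g (lie_bracket X Y) Z x - gdot g (lie_bracket X Z) Y x
     - gdot g (lie_bracket Y Z) X x).
Proof.
move=> sX sY sZ Ux; rewrite !nabla_metric//.
rewrite (gdotC Y (nabla g X Z))// (gdotC X (nabla g Y Z))//.
rewrite (gdotC X (nabla g Z Y))// !gdotE -!nabla_torsion_free// !dotBl.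
by field.
Qed.

End LeviCivita.

(** * The threading frame *)

Lemma minkowski_unit (R : realType) : Defs.minkowski R \in unitmx.
Proof.
rewrite unitmxE unitfE det_diag prodf_seq_neq0; apply/allP => a _ /=.
by rewrite mxE; case: ifP; rewrite ?oppr_eq0 oner_eq0.
Qed.

Lemma lorentzian_unit (R : realType) (G : 'M[R]_4) :
  lorentzian G -> G \in unitmx.
Proof.
case=> _ [P Pu PGP]; have := minkowski_unit R.
by rewrite -PGP !unitmx_mul => /andP[/andP[]].
Qed.

Section Frame.
Variables (R : realType) (U : set 'rV[R]_4).
Variables (g : 'rV[R]_4 -> 'M[R]_4) (Phi : scalar_field R).
Hypothesis U_open : open U.
Hypothesis g_smooth : forall a b, smooth_on U (fun x => g x a b).
Hypothesis g_lorentz : forall x, U x -> lorentzian (g x).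
Hypothesis Phi_smooth : smooth_on U Phi.
Hypothesis Phi_neq0 : forall x, U x -> Phi x != 0.
Hypothesis xi_norm : forall x, U x -> gdot g (xi R) (xi R) x = - Phi x ^+ 2.

Local Notation δ := (delta g Phi).
Local Notation ξ := (xi R).
Local Notation nab := (nabla g).
Local Notation Γ := (sGamma g Phi).
Local Notation KK := (K g Phi).

Let g_sym x (Ux : U x) : (g x)^T = g x := (g_lorentz Ux).1.

Let g_unit x (Ux : U x) : g x \in unitmx := lorentzian_unit (g_lorentz Ux).

Lemma smooth_coord_vf a : vsmooth_on U (coord_vf R a).
Proof. by move=> c; apply: smooth_cst. Qed.

Lemma smooth_xi : vsmooth_on U ξ.
Proof. exact: smooth_coord_vf. Qed.

Lemma smooth_A i : smooth_on U (A g Phi i).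
Proof.
apply: smoothN => //; apply: smoothM => //.
  apply: smoothV => //; last exact: smoothX.
  by move=> x Ux; rewrite expf_neq0// Phi_neq0.
by apply: smooth_gdot => //; apply: smooth_coord_vf.
Qed.

Lemma smooth_delta i : vsmooth_on U (δ i).
Proof.
move=> c.
apply: (smooth_eq U_open
  (f := fun x => coord_vf R (sp i) x 0 c - A g Phi i x * ξ x 0 c)).
  by move=> x _; rewrite !mxE.
apply: smoothB => //; first exact: smooth_coord_vf.
by apply: smoothM => //; [exact: smooth_A|exact: smooth_xi].
Qed.

Lemma smooth_gbar i j : smooth_on U (gbar g Phi i j).
Proof. by apply: smooth_gdot => //; apply: smooth_delta. Qed.

Lemma smooth_Theta i j : smooth_on U (Theta g Phi i j).
Proof.
apply: smoothM => //; first exact: smooth_cst.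
exact/smooth_pd/smooth_gbar.
Qed.

Lemma smooth_omega i j : smooth_on U (omega g Phi i j).
Proof.
apply: smoothM => //; first exact: smooth_cst.
by apply: smoothB => //; apply: smooth_vact => //;
  do ?[exact: smooth_delta | exact: smooth_A].
Qed.

Lemma smooth_K i j : smooth_on U (KK i j).
Proof.
apply: smoothD => //; first exact: smooth_Theta.
by apply: smoothM => //; [exact: smoothX|exact: smooth_omega].
Qed.

Lemma smooth_b i : smooth_on U (b_ g Phi i).
Proof.
apply: smoothD => //; first by apply: smoothN => //; apply/smooth_pd/smooth_A.
apply: smoothM => //; first exact: smoothV.
by apply: smooth_vact => //; apply: smooth_delta.
Qed.

Section AtPoint.
Variables (x : 'rV[R]_4) (Ux : U x).

Lemma delta_xi i : gdot g (δ i) ξ x = 0.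
Proof.
rewrite gdotE /delta dotBl dotZl -!gdotE xi_norm// /A.
by field; rewrite Phi_neq0.
Qed.

Lemma xi_delta i : gdot g ξ (δ i) x = 0.
Proof. by rewrite (gdotC g_sym)// delta_xi. Qed.

Lemma xi_sp k : ξ x 0 (sp k) = 0.
Proof. by rewrite mxE. Qed.

Lemma xi_0 : ξ x 0 ord0 = 1.
Proof. by rewrite mxE. Qed.

Lemma delta_sp h k : δ h x 0 (sp k) = (h == k)%:R.
Proof.
rewrite 4!mxE xi_sp mulr0 subr0 eqxx /=.
by rewrite (inj_eq lift_inj) eq_sym.
Qed.

Lemma delta_0 h : δ h x 0 ord0 = - A g Phi h x.
Proof. by rewrite 4!mxE xi_0 mulr1 /= sub0r. Qed.

Lemma frame_decomp (v : 'rV[R]_4) :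
  v = \sum_h v 0 (sp h) *: δ h x
      + (v 0 ord0 + \sum_h v 0 (sp h) * A g Phi h x) *: ξ x.
Proof.
apply/rowP => a; rewrite mxE [X in _ + X]mxE summxE.
under eq_bigr => h _ do rewrite mxE.
case: (unliftP ord0 a) => [k ->|->].
  rewrite xi_sp mulr0 addr0 (bigD1 k)//= big1 ?addr0 => [|h /negPf hk].
    by rewrite delta_sp eqxx mulr1.
  by rewrite delta_sp hk mulr0.
rewrite xi_0 mulr1 addrCA -big_split big1 ?addr0//= => h _.
by rewrite delta_0; ring.
Qed.

(** A spatial vector orthogonal to every [δ k] is orthogonal to the whole
    frame, so it vanishes because [g x] is non-degenerate. *)
Lemma gbar_unit : \matrix_(h, k) gbar g Phi h k x \in unitmx.
Proof.
rewrite -row_free_unit; apply: inj_row_free => w w0.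
pose u : 'rV[R]_4 := \sum_h w 0 h *: δ h x.
have u0 v : dot (g x) u v = 0.
  rewrite (frame_decomp v) dotDr dotZr dot_sumr.
  rewrite [X in _ + _ * X]dot_suml [X in _ + _ * X]big1 ?mulr0 ?addr0.
    apply: big1 => k _; rewrite dotZr dot_suml.
    transitivity (v 0 (sp k) * (w *m \matrix_(h, k) gbar g Phi h k x) 0 k).
      rewrite mxE; congr (_ * _); apply: eq_bigr => h _.
      by rewrite dotZl mxE /gbar gdotE.
    by rewrite w0 mxE mulr0.
  by move=> h _; rewrite dotZl -gdotE delta_xi mulr0.
have {}u0 : u = 0.
  have : u *m g x = 0.
    apply/rowP => a; have := u0 (delta_mx 0 a).
    by rewrite /dot trmx_delta -colE !mxE.
  by move/(congr1 (fun v => v *m invmx (g x))); rewrite mulmxK ?g_unit// mul0mx.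
apply/rowP => k; have := congr1 (fun v : 'rV_4 => v 0 (sp k)) u0.
rewrite summxE mxE (bigD1 k)//= mxE delta_sp eqxx mulr1 big1 ?addr0.
  by move=> ->; rewrite mxE.
by move=> h /negPf hk; rewrite mxE delta_sp hk mulr0.
Qed.

(** The frame is orthogonal apart from its spatial block, so products are
    computed with the inverse of [gbar] on the spatial part and with
    [g ξ ξ = - Phi ^+ 2] on the part along [ξ]. *)
Lemma frame_parseval (X Y : vector_field R) :
  gdot g X Y x =
  \sum_h (\sum_l gbar_inv g Phi h l x * gdot g X (δ l) x) * gdot g Y (δ h) x
  - Phi x ^- 2 * gdot g X ξ x * gdot g Y ξ x.
Proof.
set u := X x; pose t := u 0 ord0 + \sum_h u 0 (sp h) * A g Phi h x.
have uE : u = \sum_h u 0 (sp h) *: δ h x + t *: ξ x by apply: frame_decomp.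
have uxi : gdot g X ξ x = - Phi x ^+ 2 * t.
  rewrite gdotE -/u uE dotDl dotZl -gdotE xi_norm// dot_suml big1 ?add0r.
    by rewrite mulrC.
  by move=> h _; rewrite dotZl -gdotE delta_xi mulr0.
have udl l : gdot g X (δ l) x = \sum_k u 0 (sp k) * gbar g Phi k l x.
  rewrite gdotE -/u uE dotDl dotZl -gdotE xi_delta mulr0 addr0 dot_suml.
  by apply: eq_bigr => k _; rewrite dotZl -gdotE -uE.
have coordE h : \sum_l gbar_inv g Phi h l x * gdot g X (δ l) x = u 0 (sp h).
  pose G : 'M[R]_3 := \matrix_(h, k) gbar g Phi h k x.
  have GT : G^T = G.
    by apply/matrixP => i j; rewrite !mxE /gbar (gdotC g_sym).
  pose w : 'rV[R]_3 := \row_k u 0 (sp k).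
  transitivity ((w *m G *m invmx G) 0 h).
    rewrite mxE; apply: eq_bigr => l _; rewrite mulrC udl mxE; congr (_ * _).
      by apply: eq_bigr => k _; rewrite !mxE.
    by rewrite /gbar_inv -/G -[in RHS]GT -trmx_inv mxE.
  by rewrite mulmxK ?gbar_unit// mxE.
rewrite [in LHS]gdotE -/u [in LHS]uE dotDl dotZl dot_suml; congr (_ + _).
  by apply: eq_bigr => h _; rewrite dotZl coordE (gdotC g_sym)// gdotE.
rewrite uxi (gdotC g_sym Y)// -gdotE; field; exact: Phi_neq0.
Qed.

End AtPoint.

Section Connection.
Variables (x : 'rV[R]_4) (Ux : U x).

Lemma vact_gdot_delta_xi X i : vact X (gdot g (δ i) ξ) x = 0.
Proof.
rewrite (vact_eq_on U_open Ux _ (h := fun=> 0)) ?vact_cst// => y Uy.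
exact: delta_xi.
Qed.

Lemma vact_gdot_xi_delta X i : vact X (gdot g ξ (δ i)) x = 0.
Proof.
rewrite (vact_eq_on U_open Ux _ (h := fun=> 0)) ?vact_cst// => y Uy.
exact: xi_delta.
Qed.

Lemma vact_sqr X f : smooth_on U f ->
  vact X (fun y => f y ^+ 2) x = 2 * f x * vact X f x.
Proof.
move=> sf; rewrite (vact_eq_on U_open Ux _ (h := fun y => f y * f y)).
  by rewrite (vactM Ux)//; ring.
by move=> y _; rewrite expr2.
Qed.

Lemma vact_gdot_xi_xi X : vact X (gdot g ξ ξ) x = - (2 * Phi x * vact X Phi x).
Proof.
rewrite (vact_eq_on U_open Ux _ (h := fun y => - Phi y ^+ 2))//.
by rewrite (vactN U_open Ux) ?vact_sqr//; apply: smoothX.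
Qed.

Lemma lie_bracketC (X Y : vector_field R) :
  lie_bracket X Y x = - lie_bracket Y X x.
Proof. by apply/rowP => c; rewrite !mxE; ring. Qed.

(** The component of [δ i] along [sp k] is constant, so a bracket only sees the
    component [- A i] along the time coordinate. *)
Lemma lie_delta_delta i j :
  lie_bracket (δ i) (δ j) x = (- (2 * omega g Phi i j x)) *: ξ x.
Proof.
apply/rowP => c; rewrite mxE [RHS]mxE /omega.
case: (unliftP ord0 c) => [k ->|->].
  rewrite !(vact_eq_on U_open Ux (f := fun y => δ _ y 0 (sp k)) _
     (fun y _ => delta_sp y _ k)).
  by rewrite !vact_cst xi_sp mulr0 subr0.
rewrite !(vact_eq_on U_open Ux (f := fun y => δ _ y 0 ord0) _
     (fun y _ => delta_0 y _)).
rewrite (vactN U_open Ux (δ i) (smooth_A j)) (vactN U_open Ux (δ j) (smooth_A i)).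
by rewrite xi_0; field.
Qed.

Lemma lie_delta_xi k : lie_bracket (δ k) ξ x = (- a_ g Phi k x) *: ξ x.
Proof.
apply/rowP => c; rewrite mxE [RHS]mxE /a_ opprK -vact_xi.
rewrite (vact_eq_on U_open Ux (f := fun y => ξ y 0 c) _
  (h := fun=> ξ x 0 c))// vact_cst sub0r.
case: (unliftP ord0 c) => [l ->|->].
  rewrite (vact_eq_on U_open Ux (f := fun y => δ _ y 0 (sp l)) _
     (fun y _ => delta_sp y _ l)).
  by rewrite vact_cst xi_sp mulr0 oppr0.
rewrite (vact_eq_on U_open Ux (f := fun y => δ _ y 0 ord0) _
     (fun y _ => delta_0 y _)).
by rewrite xi_0 mulr1 (vactN U_open Ux ξ (smooth_A k)) opprK.
Qed.

Lemma lie_xi_xi : lie_bracket ξ ξ x = 0 *: ξ x.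
Proof. by rewrite scale0r; apply/rowP => c; rewrite mxE subrr mxE. Qed.

Lemma lie_xi_delta k : lie_bracket ξ (δ k) x = a_ g Phi k x *: ξ x.
Proof. by rewrite lie_bracketC lie_delta_xi -scaleNr opprK. Qed.

Lemma omegaC i j : omega g Phi i j x = - omega g Phi j i x.
Proof. by rewrite /omega; ring. Qed.

Lemma vact_gbarC X i j : vact X (gbar g Phi i j) x = vact X (gbar g Phi j i) x.
Proof. by apply: (vact_eq_on U_open Ux) => y Uy; rewrite /gbar (gdotC g_sym). Qed.

Lemma ThetaC i j : Theta g Phi i j x = Theta g Phi j i x.
Proof. by rewrite /Theta -!vact_xi vact_gbarC. Qed.

Lemma vact_xi_gdot_delta i j :
  vact ξ (gdot g (δ i) (δ j)) x = 2 * Theta g Phi i j x.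
Proof. by rewrite vact_xi /Theta; field. Qed.

Lemma gdot_lie_delta_delta i j Z :
  gdot g (lie_bracket (δ i) (δ j)) Z x =
  - (2 * omega g Phi i j x) * gdot g ξ Z x.
Proof. by rewrite gdotE lie_delta_delta dotZl -gdotE. Qed.

Lemma gdot_lie_delta_xi k Z :
  gdot g (lie_bracket (δ k) ξ) Z x = - a_ g Phi k x * gdot g ξ Z x.
Proof. by rewrite gdotE lie_delta_xi dotZl -gdotE. Qed.

Lemma gdot_lie_xi_delta k Z :
  gdot g (lie_bracket ξ (δ k)) Z x = a_ g Phi k x * gdot g ξ Z x.
Proof. by rewrite gdotE lie_xi_delta dotZl -gdotE. Qed.

Lemma gdot_lie_xi_xi Z : gdot g (lie_bracket ξ ξ) Z x = 0.
Proof. by rewrite gdotE lie_xi_xi dotZl mul0r. Qed.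

(** In this form the six terms of the Koszul formula are supplied already
    evaluated on the frame. *)
Lemma koszul_val X Y Z (vX vY vZ bXY bXZ bYZ : R) :
  vsmooth_on U X -> vsmooth_on U Y -> vsmooth_on U Z ->
  vact X (gdot g Y Z) x = vX -> vact Y (gdot g X Z) x = vY ->
  vact Z (gdot g X Y) x = vZ ->
  gdot g (lie_bracket X Y) Z x = bXY -> gdot g (lie_bracket X Z) Y x = bXZ ->
  gdot g (lie_bracket Y Z) X x = bYZ ->
  gdot g (nab X Y) Z x = 2^-1 * (vX + vY - vZ + bXY - bXZ - bYZ).
Proof.
move=> sX sY sZ <- <- <- <- <- <-.
exact: (koszul U_open g_smooth g_sym g_unit).
Qed.

Lemma nabla_delta_delta_xi i j : gdot g (nab (δ j) (δ i)) ξ x = - KK i j x.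
Proof.
rewrite (koszul_val (smooth_delta j) (smooth_delta i) smooth_xi
  (vact_gdot_delta_xi _ i) (vact_gdot_delta_xi _ j) (vact_xi_gdot_delta j i)
  (gdot_lie_delta_delta j i _) (gdot_lie_delta_xi j _) (gdot_lie_delta_xi i _)).
rewrite (xi_delta Ux i) (xi_delta Ux j) (xi_norm Ux).
by rewrite /K (omegaC j) (ThetaC j); field.
Qed.

Lemma nabla_delta_delta_delta i j h :
  gdot g (nab (δ j) (δ i)) (δ h) x = 2^-1 *
   (vact (δ i) (gbar g Phi h j) x + vact (δ j) (gbar g Phi h i) x
    - vact (δ h) (gbar g Phi i j) x).
Proof.
rewrite (koszul_val (smooth_delta j) (smooth_delta i) (smooth_delta h)
  (vact_gbarC _ i h) (vact_gbarC _ j h) (vact_gbarC _ j i)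
  (gdot_lie_delta_delta j i _) (gdot_lie_delta_delta j h _) (gdot_lie_delta_delta i h _)).
rewrite (xi_delta Ux i) (xi_delta Ux j) (xi_delta Ux h).
have E (p q r u v w : R) : 2^-1 * (p + q - r + u * 0 - v * 0 - w * 0) =
  2^-1 * (q + p - r) by ring.
exact: E.
Qed.

Lemma nabla_xi_delta_delta i h : gdot g (nab ξ (δ i)) (δ h) x = KK h i x.
Proof.
rewrite (koszul_val smooth_xi (smooth_delta i) (smooth_delta h)
  (vact_xi_gdot_delta i h) (vact_gdot_xi_delta _ h) (vact_gdot_xi_delta _ i)
  (gdot_lie_xi_delta i _) (gdot_lie_xi_delta h _) (gdot_lie_delta_delta i h _)).
rewrite (xi_delta Ux i) (xi_delta Ux h) (xi_norm Ux).
by rewrite /K (omegaC h) (ThetaC h); field.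
Qed.

Lemma nabla_delta_xi_delta i j : gdot g (nab (δ j) ξ) (δ i) x = KK i j x.
Proof.
rewrite (koszul_val (smooth_delta j) smooth_xi (smooth_delta i)
  (vact_gdot_xi_delta _ i) (vact_xi_gdot_delta j i) (vact_gdot_delta_xi _ j)
  (gdot_lie_delta_xi j _) (gdot_lie_delta_delta j i _) (gdot_lie_xi_delta i _)).
rewrite (xi_delta Ux i) (xi_delta Ux j) (xi_norm Ux).
by rewrite /K (omegaC j) (ThetaC j); field.
Qed.

Lemma nabla_delta_xi_xi i :
  gdot g (nab (δ i) ξ) ξ x = - Phi x ^+ 2 * c_ g Phi i x.
Proof.
rewrite (koszul_val (smooth_delta i) smooth_xi smooth_xi
  (vact_gdot_xi_xi _) (vact_gdot_delta_xi _ i) (vact_gdot_delta_xi _ i)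
  (gdot_lie_delta_xi i _) (gdot_lie_delta_xi i _) (gdot_lie_xi_xi _)).
rewrite (xi_norm Ux).
by rewrite /b_ /c_; field; apply: Phi_neq0.
Qed.

Lemma nabla_xi_delta_xi i :
  gdot g (nab ξ (δ i)) ξ x = - Phi x ^+ 2 * b_ g Phi i x.
Proof.
rewrite (koszul_val smooth_xi (smooth_delta i) smooth_xi
  (vact_gdot_delta_xi _ i) (vact_gdot_xi_xi _) (vact_gdot_xi_delta _ i)
  (gdot_lie_xi_delta i _) (gdot_lie_xi_xi _) (gdot_lie_delta_xi i _)).
rewrite (xi_norm Ux).
by rewrite /b_ /c_; field; apply: Phi_neq0.
Qed.

Lemma nabla_xi_xi_delta i :
  gdot g (nab ξ ξ) (δ i) x = Phi x ^+ 2 * b_ g Phi i x.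
Proof.
rewrite (koszul_val smooth_xi smooth_xi (smooth_delta i)
  (vact_gdot_xi_delta _ i) (vact_gdot_xi_delta _ i) (vact_gdot_xi_xi _)
  (gdot_lie_xi_xi _) (gdot_lie_xi_delta i _) (gdot_lie_xi_delta i _)).
rewrite (xi_norm Ux).
by rewrite /b_ /c_; field; apply: Phi_neq0.
Qed.

Lemma nabla_xi_xi_xi : gdot g (nab ξ ξ) ξ x = - Phi x ^+ 2 * Psi Phi x.
Proof.
rewrite (koszul_val smooth_xi smooth_xi smooth_xi
  (vact_gdot_xi_xi _) (vact_gdot_xi_xi _) (vact_gdot_xi_xi _)
  (gdot_lie_xi_xi _) (gdot_lie_xi_xi _) (gdot_lie_xi_xi _)).
by rewrite /Psi vact_xi; field; apply: Phi_neq0.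
Qed.

(** The spatial part of the covariant derivative of a spatial frame field is
    given by the coefficients of the spatial connection. *)
Lemma delta_components i j h :
  \sum_l gbar_inv g Phi h l x * gdot g (nab (δ j) (δ i)) (δ l) x = Γ h i j x.
Proof.
rewrite /sGamma mulr_sumr; apply: eq_bigr => l _.
rewrite nabla_delta_delta_delta; exact: mulrCA.
Qed.

Lemma xi_components i h :
  \sum_l gbar_inv g Phi h l x * gdot g (nab ξ (δ i)) (δ l) x =
  raise g Phi KK h i x.
Proof. by apply: eq_bigr => l _; rewrite nabla_xi_delta_delta. Qed.

End Connection.

(** * Gauss and Codazzi equations *)

Definition spatial (X : vector_field R) := forall y, U y -> gdot g X ξ y = 0.

Lemma spatial_delta i : spatial (δ i).
Proof. by move=> y Uy; apply: delta_xi. Qed.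

Lemma sproj_spatial X x : spatial X -> U x -> sproj g X x = X x.
Proof. by move=> sX Ux; rewrite /sproj sX// mul0r scale0r subr0. Qed.

Lemma spatial_sproj X : spatial (sproj g X).
Proof.
move=> y Uy; rewrite gdotE /sproj dotBl dotZl -!gdotE xi_norm//.
by field; apply: Phi_neq0.
Qed.

Lemma gdot_sproj X W x : spatial W -> U x ->
  gdot g (sproj g X) W x = gdot g X W x.
Proof.
move=> sW Ux; rewrite gdotE /sproj dotBl dotZl -!gdotE.
by rewrite (gdotC g_sym ξ W)// sW// mulr0 subr0.
Qed.

Lemma sproj_eq (X X' : vector_field R) y :
  X y = X' y -> sproj g X y = sproj g X' y.
Proof. by rewrite /sproj !gdotE => ->. Qed.

(** Spatial fields are fixed by the projection on all of [U], hence may be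
    replaced by their projections under a derivative. *)
Lemma snabla_spatial Y Z y : spatial Z -> U y ->
  snabla g Y (sproj g Z) y = sproj g (nab Y Z) y.
Proof.
move=> sZ Uy; apply: sproj_eq.
apply: (nabla_eq_on g U_open) => // z Uz.
by rewrite (sproj_spatial (spatial_sproj _) Uz) (sproj_spatial sZ Uz).
Qed.

(** The projection adds to [nab Y Z] the multiple
    [Phi ^- 2 * gdot g (nab Y Z) ξ] of [ξ]. When it is differentiated along [X]
    and paired with the spatial field [W], the derivative of the coefficient
    drops out, since [ξ] is orthogonal to [W]. *)
Lemma gdot_snabla2 X Y Z W x :
  vsmooth_on U Y -> vsmooth_on U Z -> spatial Z -> spatial W -> U x ->
  gdot g (snabla g X (snabla g Y (sproj g Z))) W x =
  gdot g (nab X (nab Y Z)) W x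
  + Phi x ^- 2 * gdot g (nab Y Z) ξ x * gdot g (nab X ξ) W x.
Proof.
move=> sY sZ spZ spW Ux; rewrite gdot_sproj// !gdotE.
pose f y := Phi y ^- 2 * gdot g (nab Y Z) ξ y.
have sV := vsmooth_nabla U_open g_smooth g_unit sY sZ.
have sf : smooth_on U f.
  apply: smoothM => //; last by apply: smooth_gdot => //; apply: smooth_xi.
  apply: smoothV => //; last exact: smoothX.
  by move=> y Uy; rewrite expf_neq0// Phi_neq0.
have -> : nab X (sproj g (snabla g Y (sproj g Z))) x =
          nab X (fun y => nab Y Z y + f y *: ξ y) x.
  apply: (nabla_eq_on g U_open) => // y Uy.
  have spV : spatial (snabla g Y (sproj g Z)) by apply: spatial_sproj.
  rewrite (sproj_spatial spV Uy) (snabla_spatial Y spZ Uy).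
  rewrite /sproj -scaleNr (xi_norm Uy) /f; congr (_ + _ *: _).
  by field; apply: Phi_neq0.
rewrite (nablaDZ g U_open X sV smooth_xi sf Ux).
rewrite !dotDl !dotZl -[dot _ (ξ x) _]gdotE (gdotC g_sym ξ W Ux) (spW x Ux).
by rewrite mulr0 addr0 -!gdotE.
Qed.

Lemma riemann4E X Y Z W x : riemann4 g X Y W Z x =
  gdot g (nab X (nab Y Z)) W x - gdot g (nab Y (nab X Z)) W x
  - gdot g (nab (lie_bracket X Y) Z) W x.
Proof. by rewrite /riemann4 4!gdotE /riemann 2!dotBl. Qed.

Lemma sriemann4E X Y Z W x : spatial W -> U x -> sriemann4 g X Y W Z x =
  gdot g (snabla g X (snabla g Y (sproj g Z))) W x
  - gdot g (snabla g Y (snabla g X (sproj g Z))) W x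
  - gdot g (snabla g (lie_bracket X Y) (sproj g Z)) W x.
Proof.
move=> spW Ux; apply: etrans (gdotE g _ _ _) _.
rewrite (sproj_spatial spW Ux) /sriemann 2!dotBl.
by congr (_ - _ - _); rewrite gdotE.
Qed.

(** Two applications of [gdot_snabla2]; the bracket term is the same on both
    sides, since pairing with a spatial field forgets the projection. *)
Lemma gauss X Y Z W x :
  vsmooth_on U X -> vsmooth_on U Y -> vsmooth_on U Z ->
  spatial Z -> spatial W -> U x ->
  riemann4 g X Y W Z x = sriemann4 g X Y W Z x
  - Phi x ^- 2 * gdot g (nab Y Z) ξ x * gdot g (nab X ξ) W x
  + Phi x ^- 2 * gdot g (nab X Z) ξ x * gdot g (nab Y ξ) W x.
Proof.
move=> sX sY sZ spZ spW Ux.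
rewrite riemann4E (sriemann4E X Y Z spW Ux).
have bE : gdot g (snabla g (lie_bracket X Y) (sproj g Z)) W x =
          gdot g (nab (lie_bracket X Y) Z) W x.
  by rewrite gdotE (snabla_spatial _ spZ Ux) -gdotE (gdot_sproj _ spW Ux).
have E (n1 n2 n3 s1 s2 s3 p q : R) : s1 = n1 + p -> s2 = n2 + q -> s3 = n3 ->
  n1 - n2 - n3 = s1 - s2 - s3 - p + q by move=> -> -> ->; ring.
exact: E (gdot_snabla2 X sY sZ spZ spW Ux) (gdot_snabla2 Y sX sZ spZ spW Ux) bE.
Qed.

(** Metricity along [X] and [Y] for the products with [ξ] that are
    differentiated in the two second-order terms. *)
Lemma codazzi X Y Z x :
  vsmooth_on U X -> vsmooth_on U Y -> vsmooth_on U Z -> U x ->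
  riemann4 g X Y ξ Z x =
  vact X (gdot g (nab Y Z) ξ) x - vact Y (gdot g (nab X Z) ξ) x
  - gdot g (nab Y Z) (nab X ξ) x + gdot g (nab X Z) (nab Y ξ) x
  - gdot g (nab (lie_bracket X Y) Z) ξ x.
Proof.
move=> sX sY sZ Ux; rewrite riemann4E.
have sYZ := vsmooth_nabla U_open g_smooth g_unit sY sZ.
have sXZ := vsmooth_nabla U_open g_smooth g_unit sX sZ.
have E (n1 n2 n3 v1 v2 p q : R) : v1 = n1 + p -> v2 = n2 + q ->
  n1 - n2 - n3 = v1 - v2 - p + q - n3 by move=> -> ->; ring.
have metric V W (sW : vsmooth_on U W) :=
  nabla_metric U_open g_smooth g_sym g_unit V sW smooth_xi Ux.
exact: E (metric X _ sYZ) (metric Y _ sXZ).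
Qed.

(** * The structure equations *)

(** Each equation below ends with an identity of scalars [E], in which every
    product of fields is replaced by a variable subject to its known value. *)
Section Structure.
Variables (x : 'rV[R]_4) (Ux : U x).

Lemma vact_phi2M X f : smooth_on U f ->
  vact X (fun y => Phi y ^+ 2 * f y) x =
  2 * Phi x * vact X Phi x * f x + Phi x ^+ 2 * vact X f x.
Proof.
move=> sf; rewrite (vactM Ux X (smoothX U_open 2 Phi_smooth) sf).
by rewrite (vact_sqr Ux X Phi_smooth).
Qed.

Lemma structure_iljk i j k l :
  R_iljk g Phi i l j k x = Rbar_iljk g Phi i l j k x
    + Phi x ^- 2 * (KK i j x * KK l k x - KK i k x * KK l j x).
Proof.
have E (r p a b c d t1 b1 t2 b2 : R) :
  t1 = - a -> b1 = b -> t2 = - c -> b2 = d ->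
  r - p * t1 * b1 + p * t2 * b2 = r + p * (a * b - c * d).
  by move=> -> -> -> ->; ring.
apply: etrans (gauss (smooth_delta k) (smooth_delta j) (smooth_delta i)
  (spatial_delta i) (spatial_delta l) Ux) _.
exact: E (nabla_delta_delta_xi Ux i j) (nabla_delta_xi_delta Ux l k)
  (nabla_delta_delta_xi Ux i k) (nabla_delta_xi_delta Ux l j).
Qed.

Lemma structure_il0k i k l :
  R_il0k g Phi i l k x = Rbar_il0k g Phi i l k x
    + b_ g Phi i x * KK l k x - b_ g Phi l x * KK i k x.
Proof.
have E (p r a b c d t1 b1 t2 b2 : R) : p != 0 ->
  t1 = - p ^+ 2 * a -> b1 = b -> t2 = - d -> b2 = p ^+ 2 * c ->
  r - p ^- 2 * t1 * b1 + p ^- 2 * t2 * b2 = r + a * b - c * d.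
  by move=> p0 -> -> -> ->; field.
apply: etrans (gauss (smooth_delta k) smooth_xi (smooth_delta i)
  (spatial_delta i) (spatial_delta l) Ux) _.
exact: E (Phi_neq0 Ux) (nabla_xi_delta_xi Ux i) (nabla_delta_xi_delta Ux l k)
  (nabla_delta_delta_xi Ux i k) (nabla_xi_xi_delta Ux l).
Qed.

(** Frame expansion of a product whose factors have known components: [p] and
    [q] are the covariant spatial components, [P] the contravariant ones. *)
Lemma parseval_val X Y (P q : 'I_3 -> R) (p0 q0 : R) :
  (forall h, \sum_l gbar_inv g Phi h l x * gdot g X (δ l) x = P h) ->
  (forall h, gdot g Y (δ h) x = q h) ->
  gdot g X ξ x = p0 -> gdot g Y ξ x = q0 ->
  gdot g X Y x = \sum_h P h * q h - Phi x ^- 2 * p0 * q0.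
Proof.
move=> XP Yq <- <-; apply: etrans (frame_parseval Ux X Y) _.
by congr (_ - _); apply: eq_bigr => h _; rewrite XP Yq.
Qed.

(** The brackets of frame fields are vertical, so the bracket term of the
    curvature reduces to [nabla_xi_delta_xi]. *)
Lemma gdot_lie_nabla i (c : R) X : X x = c *: ξ x ->
  gdot g (nab X (δ i)) ξ x = c * (- Phi x ^+ 2 * b_ g Phi i x).
Proof.
move=> XE; rewrite gdotE (nablaZl g (δ i) XE) dotZl -gdotE.
by rewrite nabla_xi_delta_xi.
Qed.

Lemma vact_nabla_delta_delta X i j :
  vact X (gdot g (nab (δ j) (δ i)) ξ) x = - vact X (KK i j) x.
Proof.
rewrite -(vactN U_open Ux X (smooth_K i j)).
by apply: (vact_eq_on U_open Ux) => y Uy; apply: nabla_delta_delta_xi.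
Qed.

Lemma vact_nabla_xi_delta X i :
  vact X (gdot g (nab ξ (δ i)) ξ) x =
  - (2 * Phi x * vact X Phi x * b_ g Phi i x
     + Phi x ^+ 2 * vact X (b_ g Phi i) x).
Proof.
rewrite -(vact_phi2M X (smooth_b i)).
have sf := smoothM U_open (smoothX U_open 2 Phi_smooth) (smooth_b i).
rewrite -(vactN U_open Ux X sf).
by apply: (vact_eq_on U_open Ux) => y Uy; rewrite -mulNr; apply: nabla_xi_delta_xi.
Qed.

Lemma sGammaC h j k : Γ h j k x = Γ h k j x.
Proof.
have E (p a b c d : R) : c = d -> p * (a + b - c) = p * (b + a - d).
  by move=> ->; rewrite [a + b]addrC.
apply: (congr1 (fun s => 2^-1 * s)); apply: eq_bigr => l _.
exact: E (vact_gbarC Ux (δ l) j k).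
Qed.

(** In [bar2], the Christoffel terms acting on the second index cancel by the
    symmetry [sGammaC]; those acting on the first index come from
    [gdot g (nab (δ j) (δ i)) (nab (δ k) ξ)]. The terms in [c_] are the
    contribution of the component of [nab (δ k) ξ] along [ξ]. *)
Lemma structure_i0jk i j k :
  R_i0jk g Phi i j k x =
    bar2 g Phi KK i k j x - bar2 g Phi KK i j k x
    + KK i j x * c_ g Phi k x - KK i k x * c_ g Phi j x
    + 2 * Phi x ^+ 2 * b_ g Phi i x * omega g Phi j k x.
Proof.
have E (f v1 v2 p q n dK1 dK2 S1 S1' S2 S2' S S' Kij Kik ck cj b w w' : R) :
  f != 0 -> v1 = - dK1 -> v2 = - dK2 ->
  p = S1 - f ^- 2 * (- Kij) * (- f ^+ 2 * ck) ->
  q = S2 - f ^- 2 * (- Kik) * (- f ^+ 2 * cj) ->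
  n = - (2 * w') * (- f ^+ 2 * b) -> w' = - w ->
  S1' = S1 -> S2' = S2 -> S' = S ->
  v1 - v2 - p + q - n =
  (dK2 - S1' - S') - (dK1 - S2' - S) + Kij * ck - Kik * cj
  + 2 * f ^+ 2 * b * w.
  by move=> f0 -> -> -> -> -> -> -> -> ->; field.
apply: etrans (codazzi (smooth_delta k) (smooth_delta j) (smooth_delta i) Ux) _.
apply: E (Phi_neq0 Ux) (vact_nabla_delta_delta _ _ _)
  (vact_nabla_delta_delta _ _ _) _ _
  (gdot_lie_nabla _ (lie_delta_delta Ux k j)) (omegaC x k j) _ _ _.
- apply: parseval_val (nabla_delta_delta_xi Ux i j) (nabla_delta_xi_xi Ux k).
    by move=> h; apply: delta_components.
  by move=> h; apply: nabla_delta_xi_delta.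
- apply: parseval_val (nabla_delta_delta_xi Ux i k) (nabla_delta_xi_xi Ux j).
    by move=> h; apply: delta_components.
  by move=> h; apply: nabla_delta_xi_delta.
- by apply: eq_bigr => h _; exact: mulrC.
- by apply: eq_bigr => h _; exact: mulrC.
- by apply: eq_bigr => h _; rewrite (sGammaC h j k).
Qed.

(** Up to a common sign, differentiating the factor in [Phi ^+ 2 * b_ i] gives
    [2 * Phi ^+ 2 * b_ i * c_ k], half of which is cancelled by the product with
    [nab (δ k) ξ]; the bracket adds [Phi ^+ 2 * b_ i * a_ k], which completes
    [b_ k = a_ k + c_ k]. *)
Lemma structure_i00k i k :
  R_i00k g Phi i k x =
    bar2_0 g Phi KK i k x
    + \sum_h KK i h x * raise g Phi KK h k x
    - Psi Phi x * KK i k x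
    - Phi x ^+ 2 * (bar1 g Phi (b_ g Phi) i k x
                    + b_ g Phi i x * b_ g Phi k x).
Proof.
have E (f df v1 v2 p q n bi dbi dK S1 S1' S2 S2' S Kik ak psi bk : R) :
  f != 0 -> v1 = - (2 * f * df * bi + f ^+ 2 * dbi) -> v2 = - dK ->
  p = S1 - f ^- 2 * (- f ^+ 2 * bi) * (- f ^+ 2 * (f^-1 * df)) ->
  q = S2 - f ^- 2 * (- Kik) * (- f ^+ 2 * psi) ->
  n = - ak * (- f ^+ 2 * bi) -> bk = ak + f^-1 * df ->
  S1' = S1 -> S2 = f ^+ 2 * S2' ->
  v1 - v2 - p + q - n =
  (dK - S1' - S) + S - psi * Kik - f ^+ 2 * ((dbi - S2') + bi * bk).
  by move=> f0 -> -> -> -> -> -> -> ->; field.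
have vK := vact_nabla_delta_delta ξ i k; rewrite [in RHS]vact_xi in vK.
apply: etrans (codazzi (smooth_delta k) smooth_xi (smooth_delta i) Ux) _.
apply: E (Phi_neq0 Ux) (vact_nabla_xi_delta _ _) vK _ _
  (gdot_lie_nabla _ (lie_delta_xi Ux k)) (erefl _) _ _.
- apply: parseval_val (nabla_xi_delta_xi Ux i) (nabla_delta_xi_xi Ux k).
    by move=> h; apply: xi_components.
  by move=> h; apply: nabla_delta_xi_delta.
- apply: parseval_val (nabla_delta_delta_xi Ux i k) (nabla_xi_xi_xi Ux).
    by move=> h; apply: delta_components.
  by move=> h; apply: nabla_xi_xi_delta.
- by apply: eq_bigr => h _; exact: mulrC.
- rewrite mulr_sumr; apply: eq_bigr => h _.
  exact: etrans (mulrC _ _) (esym (mulrA _ _ _)).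
Qed.

(** * Expansion and vorticity *)

Local Notation Θ := (Theta g Phi).
Local Notation ω := (omega g Phi).

Lemma sum_mulDZ (p : R) (t w G : 'I_3 -> R) :
  \sum_h (t h + p * w h) * G h = \sum_h t h * G h + p * \sum_h w h * G h.
Proof.
by rewrite mulr_sumr -big_split; apply: eq_bigr => h _ /=; rewrite mulrDl mulrA.
Qed.

Lemma vact_K X i j : vact X (KK i j) x =
  vact X (Θ i j) x + (2 * Phi x * vact X Phi x * ω i j x
                      + Phi x ^+ 2 * vact X (ω i j) x).
Proof.
rewrite -(vact_phi2M X (smooth_omega i j)).
have sf := smoothM U_open (smoothX U_open 2 Phi_smooth) (smooth_omega i j).
exact: (vactD Ux X (smooth_Theta i j) sf).
Qed.

(** The extra term comes from differentiating the factor [Phi ^+ 2]. *)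
Lemma bar2_K i j k : bar2 g Phi KK i j k x =
  bar2 g Phi Θ i j k x
  + Phi x ^+ 2 * (bar2 g Phi ω i j k x + 2 * c_ g Phi k x * ω i j x).
Proof.
have E (f df dK dT dw w SK1 SK2 ST1 ST2 Sw1 Sw2 : R) : f != 0 ->
  dK = dT + (2 * f * df * w + f ^+ 2 * dw) ->
  SK1 = ST1 + f ^+ 2 * Sw1 -> SK2 = ST2 + f ^+ 2 * Sw2 ->
  dK - SK1 - SK2 = (dT - ST1 - ST2)
    + f ^+ 2 * ((dw - Sw1 - Sw2) + 2 * (f^-1 * df) * w).
  by move=> f0 -> -> ->; field.
exact: E (Phi_neq0 Ux) (vact_K (δ k) i j)
  (sum_mulDZ _ (fun h => Θ h j x) (fun h => ω h j x) _)
  (sum_mulDZ _ (fun h => Θ i h x) (fun h => ω i h x) _).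
Qed.

Lemma bar2_0_K i j : bar2_0 g Phi KK i j x =
  bar2_0 g Phi Θ i j x
  + Phi x ^+ 2 * (bar2_0 g Phi ω i j x + 2 * Psi Phi x * ω i j x).
Proof.
have E (f df dK dT dw w SK1 SK2 ST1 ST2 Sw1 Sw2 : R) : f != 0 ->
  dK = dT + (2 * f * df * w + f ^+ 2 * dw) ->
  SK1 = ST1 + f ^+ 2 * Sw1 -> SK2 = ST2 + f ^+ 2 * Sw2 ->
  dK - SK1 - SK2 = (dT - ST1 - ST2)
    + f ^+ 2 * ((dw - Sw1 - Sw2) + 2 * (f^-1 * df) * w).
  by move=> f0 -> -> ->; field.
have vK := vact_K ξ i j; rewrite !vact_xi in vK.
exact: E (Phi_neq0 Ux) vK
  (sum_mulDZ _ (fun h => Θ h j x) (fun h => ω h j x) _)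
  (sum_mulDZ _ (fun h => Θ i h x) (fun h => ω i h x) _).
Qed.

Lemma raise_K h k :
  raise g Phi KK h k x = raise g Phi Θ h k x + Phi x ^+ 2 * raise g Phi ω h k x.
Proof.
have E (c t p w : R) : c * (t + p * w) = c * t + p * (c * w) by ring.
rewrite /raise mulr_sumr -big_split; apply: eq_bigr => i _; exact: E.
Qed.

Lemma structure_iljk_expansion i j k l :
  R_iljk g Phi i l j k x =
    Rbar_iljk g Phi i l j k x
    + Phi x ^+ 2 *
      ((ω i j x + Phi x ^- 2 * Θ i j x) * (ω l k x + Phi x ^- 2 * Θ l k x)
       - (ω i k x + Phi x ^- 2 * Θ i k x) * (ω l j x + Phi x ^- 2 * Θ l j x)).
Proof.
have E (f r t1 w1 t2 w2 t3 w3 t4 w4 : R) : f != 0 ->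
  r + f ^- 2 * ((t1 + f ^+ 2 * w1) * (t2 + f ^+ 2 * w2)
                - (t3 + f ^+ 2 * w3) * (t4 + f ^+ 2 * w4)) =
  r + f ^+ 2 * ((w1 + f ^- 2 * t1) * (w2 + f ^- 2 * t2)
                - (w3 + f ^- 2 * t3) * (w4 + f ^- 2 * t4)).
  by move=> f0; field.
apply: etrans (structure_iljk i j k l) _.
exact: E (Phi_neq0 Ux).
Qed.

Lemma structure_i0jk_expansion i j k :
  R_i0jk g Phi i j k x =
    bar2 g Phi Θ i k j x - bar2 g Phi Θ i j k x
    + Θ i j x * c_ g Phi k x - Θ i k x * c_ g Phi j x
    + Phi x ^+ 2 *
      (bar2 g Phi ω i k j x - bar2 g Phi ω i j k x
       + ω i k x * c_ g Phi j x - ω i j x * c_ g Phi k x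
       + 2 * b_ g Phi i x * ω j k x).
Proof.
have E (f B1 B2 T1 T2 W1 W2 tij tik wij wik cj ck bi w : R) :
  B1 = T1 + f ^+ 2 * (W1 + 2 * cj * wik) ->
  B2 = T2 + f ^+ 2 * (W2 + 2 * ck * wij) ->
  B1 - B2 + (tij + f ^+ 2 * wij) * ck - (tik + f ^+ 2 * wik) * cj
  + 2 * f ^+ 2 * bi * w =
  T1 - T2 + tij * ck - tik * cj
  + f ^+ 2 * (W1 - W2 + wik * cj - wij * ck + 2 * bi * w).
  by move=> -> ->; ring.
apply: etrans (structure_i0jk i j k) _.
exact: E (bar2_K i k j) (bar2_K i j k).
Qed.

Lemma structure_il0k_expansion i k l :
  R_il0k g Phi i l k x =
    Rbar_il0k g Phi i l k x
    + b_ g Phi i x * Θ l k x - b_ g Phi l x * Θ i k x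
    + Phi x ^+ 2 * (b_ g Phi i x * ω l k x - b_ g Phi l x * ω i k x).
Proof.
have E (f r bi bl t1 w1 t2 w2 : R) :
  r + bi * (t1 + f ^+ 2 * w1) - bl * (t2 + f ^+ 2 * w2) =
  r + bi * t1 - bl * t2 + f ^+ 2 * (bi * w1 - bl * w2) by ring.
apply: etrans (structure_il0k i k l) _; exact: E.
Qed.

Lemma structure_i00k_expansion i k :
  R_i00k g Phi i k x =
    bar2_0 g Phi Θ i k x - Psi Phi x * Θ i k x
    + Phi x ^+ 2 *
      (bar2_0 g Phi ω i k x + Psi Phi x * ω i k x
       + \sum_h (ω i h x + Phi x ^- 2 * Θ i h x)
                * (raise g Phi Θ h k x + Phi x ^+ 2 * raise g Phi ω h k x)
       - bar1 g Phi (b_ g Phi) i k x - b_ g Phi i x * b_ g Phi k x).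
Proof.
have E (f B T W S S' psi t w d bi bk : R) :
  B = T + f ^+ 2 * (W + 2 * psi * w) -> S = f ^+ 2 * S' ->
  B + S - psi * (t + f ^+ 2 * w) - f ^+ 2 * (d + bi * bk) =
  T - psi * t + f ^+ 2 * (W + psi * w + S' - d - bi * bk).
  by move=> -> ->; ring.
apply: etrans (structure_i00k i k) _.
apply: E (bar2_0_K i k) _; rewrite mulr_sumr; apply: eq_bigr => h _.
rewrite raise_K mulrA; congr (_ * _).
by rewrite mulrDr mulVKf ?expf_neq0 ?Phi_neq0// addrC.
Qed.

End Structure.
End Frame.

Theorem mainTheorem6 (R : realType) (U : set 'rV[R]_4)
    (g : 'rV[R]_4 -> 'M[R]_4) (Phi : scalar_field R)
    (U_open : open U)
    (g_smooth : forall a b : 'I_4, smooth_on U (fun x => g x a b))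
    (g_lorentz : forall x, U x -> lorentzian (g x))
    (Phi_smooth : smooth_on U Phi)
    (Phi_neq0 : forall x, U x -> Phi x != 0)
    (xi_norm : forall x, U x -> gdot g (xi R) (xi R) x = - Phi x ^+ 2) :
  (forall (x : 'rV[R]_4) (i j k l : 'I_3), U x ->
    [/\ R_iljk g Phi i l j k x =
          Rbar_iljk g Phi i l j k x
          + Phi x ^- 2 * (K g Phi i j x * K g Phi l k x
                          - K g Phi i k x * K g Phi l j x),
        R_i0jk g Phi i j k x =
          bar2 g Phi (K g Phi) i k j x - bar2 g Phi (K g Phi) i j k x
          + K g Phi i j x * c_ g Phi k x - K g Phi i k x * c_ g Phi j x
          + 2 * Phi x ^+ 2 * b_ g Phi i x * omega g Phi j k x,
        R_il0k g Phi i l k x =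
          Rbar_il0k g Phi i l k x
          + b_ g Phi i x * K g Phi l k x - b_ g Phi l x * K g Phi i k x
      & R_i00k g Phi i k x =
          bar2_0 g Phi (K g Phi) i k x
          + \sum_h K g Phi i h x * raise g Phi (K g Phi) h k x
          - Psi Phi x * K g Phi i k x
          - Phi x ^+ 2 * (bar1 g Phi (b_ g Phi) i k x
                          + b_ g Phi i x * b_ g Phi k x)])
  /\
  (forall (x : 'rV[R]_4) (i j k l : 'I_3), U x ->
    [/\ R_iljk g Phi i l j k x =
          Rbar_iljk g Phi i l j k x
          + Phi x ^+ 2 *
            ((omega g Phi i j x + Phi x ^- 2 * Theta g Phi i j x)
             * (omega g Phi l k x + Phi x ^- 2 * Theta g Phi l k x)
             - (omega g Phi i k x + Phi x ^- 2 * Theta g Phi i k x)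
               * (omega g Phi l j x + Phi x ^- 2 * Theta g Phi l j x)),
        R_i0jk g Phi i j k x =
          bar2 g Phi (Theta g Phi) i k j x - bar2 g Phi (Theta g Phi) i j k x
          + Theta g Phi i j x * c_ g Phi k x - Theta g Phi i k x * c_ g Phi j x
          + Phi x ^+ 2 *
            (bar2 g Phi (omega g Phi) i k j x - bar2 g Phi (omega g Phi) i j k x
             + omega g Phi i k x * c_ g Phi j x
             - omega g Phi i j x * c_ g Phi k x
             + 2 * b_ g Phi i x * omega g Phi j k x),
        R_il0k g Phi i l k x =
          Rbar_il0k g Phi i l k x
          + b_ g Phi i x * Theta g Phi l k x - b_ g Phi l x * Theta g Phi i k x
          + Phi x ^+ 2 * (b_ g Phi i x * omega g Phi l k x
                          - b_ g Phi l x * omega g Phi i k x)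
      & R_i00k g Phi i k x =
          bar2_0 g Phi (Theta g Phi) i k x - Psi Phi x * Theta g Phi i k x
          + Phi x ^+ 2 *
            (bar2_0 g Phi (omega g Phi) i k x + Psi Phi x * omega g Phi i k x
             + \sum_h (omega g Phi i h x + Phi x ^- 2 * Theta g Phi i h x)
                      * (raise g Phi (Theta g Phi) h k x
                         + Phi x ^+ 2 * raise g Phi (omega g Phi) h k x)
             - bar1 g Phi (b_ g Phi) i k x - b_ g Phi i x * b_ g Phi k x)]).
Proof.
split=> x i j k l Ux; split.
- exact: (structure_iljk U_open g_smooth g_lorentz Phi_smooth Phi_neq0 xi_norm Ux).
- exact: (structure_i0jk U_open g_smooth g_lorentz Phi_smooth Phi_neq0 xi_norm Ux).
- exact: (structure_il0k U_open g_smooth g_lorentz Phi_smooth Phi_neq0 xi_norm Ux).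
- exact: (structure_i00k U_open g_smooth g_lorentz Phi_smooth Phi_neq0 xi_norm Ux).
- exact: (structure_iljk_expansion
            U_open g_smooth g_lorentz Phi_smooth Phi_neq0 xi_norm Ux).
- exact: (structure_i0jk_expansion
            U_open g_smooth g_lorentz Phi_smooth Phi_neq0 xi_norm Ux).
- exact: (structure_il0k_expansion
            U_open g_smooth g_lorentz Phi_smooth Phi_neq0 xi_norm Ux).
- exact: (structure_i00k_expansion
            U_open g_smooth g_lorentz Phi_smooth Phi_neq0 xi_norm Ux).
Qed.
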